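(* Let $\sigma\in(0,1)$ be any fixed constant. For every $\lambda\in(\lambda_\sigma,\frac12)$, $$\liminf_{\varepsilon\to0}\frac{c_\sigma([-\varepsilon,\varepsilon])}{\varepsilon^{2\lambda}}=+\infty,$$ where $\varepsilon\to0$ through positive values.
   Context: $G$-capacity. For real $a$, $a^{+}=\max\{0,a\}$, $a^{-}=(-a)^{+}$, and for $\sigma\in(0,1]$, $G(a)=\frac12(a^{+}-\sigma^{2}a^{-})$. Let $C_{b,lip}(\mathbb{R})$ be the space of bounded Lipschitz functions on $\mathbb{R}$. For $\phi\in C_{b,lip}(\mathbb{R})$ let $u^\phi$ be the unique (bounded) viscosity solution of the $G$-heat equation $\partial_tu-G(\partial^2_{xx}u)=0$ on $[0,+\infty)\times\mathbb{R}$ with $u(0,x)=\phi(x)$, and set $\hat{\mathbb{E}}_\sigma[\phi]:=u^\phi(1,0)$. For $[a,b]\subseteq\mathbb{R}$, $$c_\sigma([a,b]):=\inf\{\hat{\mathbb{E}}_\sigma[\phi]:\ \phi\ge I_{[a,b]},\ \phi\in C_{b,lip}(\mathbb{R})\},$$ where $I_{[a,b]}$ is the indicator function of $[a,b]$. The exponent $\lambda_\sigma$. For $\lambda\in(0,\frac12)$ and $x\in\mathbb{R}$, $\varphi_\lambda(x):=\int_0^{+\infty}y^{-2\lambda}\exp\{-\frac{(y-x)^2}{2}\}dy$; primes denote derivatives in $x$. For each $\lambda\in(0,\frac12)$, $x_1^\lambda<0$ denotes the unique negative number with $\varphi_\lambda''(x_1^\lambda)=0$, $z^\lambda>0$ denotes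 the unique positive number with $\varphi_\lambda''(z^\lambda)+\varphi_\lambda''(-z^\lambda)=0$ (existence and uniqueness hold), and $\sigma_\lambda:=-x_1^\lambda/z^\lambda\in(0,1)$. The map $\lambda\mapsto\sigma_\lambda$ is a continuous strictly increasing bijection from $(0,\frac12)$ onto $(0,1)$; for $\sigma\in(0,1)$, $\lambda_\sigma\in(0,\frac12)$ denotes the unique constant with $\sigma_{\lambda_\sigma}=\sigma$. *)

(* Defs.v *)
From mathcomp Require Import all_boot all_order all_algebra.
From mathcomp Require Import all_classical all_reals all_analysis.

Set Implicit Arguments.
Unset Strict Implicit.
Unset Printing Implicit Defensive.

Import Order.TTheory GRing.Theory Num.Theory.
Import numFieldNormedType.Exports.

Local Open Scope classical_set_scope.
Local Open Scope ring_scope.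

Section GCapacity.
Context {R : realType}.

Definition G (sigma a : R) : R :=
  2^-1 * (Num.max 0 a - sigma ^+ 2 * Num.max 0 (- a)).

Definition C_b_lip : set (R -> R) :=
  [set phi | bounded_fun phi /\ lipschitz phi].

(* A point of time-space is a pair (t, x). *)
Definition dt (u : R * R -> R) (p : R * R) : R := derive1 (fun s => u (s, p.2)) p.1.
Definition dx (u : R * R -> R) (p : R * R) : R := derive1 (fun y => u (p.1, y)) p.2.
Definition dxx (u : R * R -> R) : R * R -> R := dx (dx u).

(* Class C^{1,2} on the open half-plane t > 0.  As derive1 is a total operator,
   differentiability is required separately from continuity. *)
Definition C12 (psi : R * R -> R) : Prop :=
  forall p : R * R, 0 < p.1 ->
    [/\ derivable (fun s => psi (s, p.2)) p.1 1,
        derivable (fun y => psi (p.1, y)) p.2 1,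
        derivable (fun y => dx psi (p.1, y)) p.2 1 &
        [/\ {for p, continuous psi}, {for p, continuous (dt psi)},
            {for p, continuous (dx psi)} & {for p, continuous (dxx psi)}]].

Definition viscosity_subsolution (sigma : R) (u : R * R -> R) : Prop :=
  forall (psi : R * R -> R) (p : R * R), C12 psi -> 0 < p.1 ->
    (\forall q \near p, u q - psi q <= u p - psi p) ->
    dt psi p - G sigma (dxx psi p) <= 0.

Definition viscosity_supersolution (sigma : R) (u : R * R -> R) : Prop :=
  forall (psi : R * R -> R) (p : R * R), C12 psi -> 0 < p.1 ->
    (\forall q \near p, u p - psi p <= u q - psi q) ->
    0 <= dt psi p - G sigma (dxx psi p).

(* u is a bounded continuous viscosity solution of the G-heat equation on
   [0, +oo) x R with initial datum phi; its values at t < 0 are irrelevant. *)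
Definition G_heat_solution (sigma : R) (phi : R -> R) (u : R * R -> R) : Prop :=
  [/\ {within [set p : R * R | 0 <= p.1], continuous u},
      [bounded u p | p in [set p : R * R | 0 <= p.1]],
      (forall x, u (0, x) = phi x),
      viscosity_subsolution sigma u &
      viscosity_supersolution sigma u].

(* The graph of the sublinear expectation: v = u^phi (1, 0).  It is the graph
   of a function on C_b_lip by the well-posedness of the G-heat equation. *)
Definition is_G_expectation (sigma : R) (phi : R -> R) (v : R) : Prop :=
  exists2 u, G_heat_solution sigma phi u & v = u (1, 0).

(* The set is nonempty (phi = 1), so inf does not take its default value
   for want of an element. *)
Definition G_capacity (sigma a b : R) : R :=
  inf [set v | exists phi, [/\ C_b_lip phi,
                 (forall x, \1_`[a, b] x <= phi x) &
                 is_G_expectation sigma phi v]].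

Definition varphi (lambda x : R) : R :=
  \int[lebesgue_measure]_(y in `]0, +oo[)
    (y `^ (- (2 * lambda)) * expR (- ((y - x) ^+ 2 / 2))).

Definition varphi'' (lambda : R) : R -> R := derive1n 2 (varphi lambda).

(* xget 0 P is an element of P, here the unique one, and 0 if P is empty. *)
Definition x1_of (lambda : R) : R :=
  xget 0 [set x | x < 0 /\ varphi'' lambda x = 0].

Definition z_of (lambda : R) : R :=
  xget 0 [set z | 0 < z /\ varphi'' lambda z + varphi'' lambda (- z) = 0].

Definition sigma_of (lambda : R) : R := - x1_of lambda / z_of lambda.

(* l = lambda_sigma *)
Definition is_lambda_of (sigma l : R) : Prop :=
  0 < l < 2^-1 /\ sigma_of l = sigma.

End GCapacity.

(* Main.v *)
(* With l = lambda_sigma, the G-heat equation has a self-similar solution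
   (t + eta)^(-l) f(x / sqrt(t + eta)), where f is glued from varphi_l so as to be
   C^2, and f(y) <= B exp(-y^2/2). Multiplied by eta^l / B and lowered by
   delta = exp(-eps^2/(2 eta)), it lies below every test function
   phi >= I_[-eps, eps] at time 0, hence below u^phi by comparison, so that
   c_sigma([-eps, eps]) >= c eta^l - exp(-eps^2/(2 eta)).
   For eta = eps^(2 + m) with m = (lambda - l)/l the first term is
   c eps^(2 lambda) eps^(l - lambda) and the second one is O(eps^(2 lambda)). *)
Require Import Defs.
From mathcomp Require Import all_boot all_order all_algebra.
From mathcomp Require Import all_classical all_reals all_analysis.
From mathcomp Require Import measurable_realfun.
From mathcomp Require Import ring lra.

Set Implicit Arguments.
Unset Strict Implicit.
Unset Printing Implicit Defensive.

Import Order.TTheory GRing.Theory Num.Theory.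
Import numFieldNormedType.Exports.

Local Open Scope classical_set_scope.
Local Open Scope ring_scope.

(** * The function varphi *)

Section Kernel.
Context {R : realType}.
Local Notation mu := (@lebesgue_measure R).
Implicit Types (f F : R -> R) (l x y a p : R) (k : nat).

(** Inserting [t^(-l) f(x / sqrt t)] into the G-heat equation leaves [- l f - y f' / 2 = G(f'')].
    Where [f'' >= 0] this reads [f'' + y f' + 2 l f = 0], and [varphi (- y)] is a solution with
    Gaussian decay as y grows; where [f'' <= 0] it reads [sigma^2 f'' + y f' + 2 l f = 0], with the
    even solution [varphi (y / sigma) + varphi (- y / sigma)]. A C^2 transition at [y0] needs both
    second derivatives to vanish there: [- y0] must be the negative root x1 and [y0 / sigma] the
    root z, so that [sigma = - x1 / z]. This coincidence is what singles out [lambda_sigma].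
    Lowering by delta is forced, since the profile is positive everywhere while a test function may
    vanish off the interval. Gaussian decay makes delta smaller than any power of eps as soon as
    [eps^2 / eta] grows like a power of [1 / eps]; taking eta slightly below the natural scale
    [eps^2] is paid for by the gap between [l] and [lambda]. *)

Lemma is_derive_ext (f g : R -> R) (x d d' : R) :
  f =1 g -> d = d' -> is_derive x 1 f d -> is_derive x 1 g d'.
Proof. by move=> /funext -> ->. Qed.

Lemma measurable_fun_0y f : (forall y : R, 0 < y -> {for y, continuous f}) ->
  measurable_fun (`]0%R, +oo[%classic : set R) f.
Proof.
move=> cf; apply: open_continuous_measurable_fun => //.
by move=> y; rewrite inE/= in_itv/= andbT; exact: cf.
Qed.

(** The integrands below may blow up at 0, so the fundamental theorem is applied on [[1/(n+1), +oo[]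
    and monotone convergence lets n tend to infinity. *)
Lemma ge0_FTC_0y f F l :
  (forall y : R, 0 < y -> 0 <= f y) ->
  (forall y : R, 0 < y -> {for y, continuous f}) ->
  (forall y : R, 0 < y -> is_derive y 1 F (f y)) ->
  F y @[y --> 0^'+] --> (0 : R) -> F y @[y --> +oo] --> l ->
  (\int[mu]_(y in `]0%R, +oo[) (f y)%:E = l%:E)%E.
Proof.
move=> f0 cf dF F0 Fl.
pose A (n : nat) : set R := `[n.+1%:R^-1, +oo[%classic.
have UA : \bigcup_n A n = `]0%R, +oo[%classic.
  apply/seteqP; split => [y [n _]|y]; rewrite /A/= !in_itv/= !andbT.
    by apply: lt_le_trans; rewrite invr_gt0.
  move=> y0; have [n ny] := ltr_add_invr y0.
  by exists n => //=; rewrite in_itv/= andbT ltW// -[ltLHS]add0r.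
have mA n : measurable (A n) by exact: measurable_itv.
have AU n : A n `<=` `]0%R, +oo[%classic by rewrite -UA; exact: bigcup_sup.
have mf := measurable_fun_0y cf.
have intA n : (\int[mu]_(y in A n) (f y)%:E = (l - F (n.+1%:R^-1))%:E)%E.
  have n0 : 0 < n.+1%:R^-1 :> R by rewrite invr_gt0.
  rewrite EFinB; apply: ge0_continuous_FTC2y => //.
  - by move=> x nx; apply: f0; apply: lt_le_trans nx.
  - apply/continuous_within_itvcyP; split => [x|].
      by rewrite in_itv/= andbT => nx; apply: cf; apply: lt_trans nx.
    exact/cvg_at_right_filter/cf.
  - by move=> x nx; have [] := dF x (lt_trans n0 nx).
  - apply/cvg_at_right_filter/differentiable_continuous/derivable1_diffP.
    by have [] := dF _ n0.
  - move=> x; rewrite in_itv/= andbT => nx; rewrite derive1E.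
    by have [] := dF x (lt_trans n0 nx).
have : (\int[mu]_(x in A n) (f x)%:E)%E @[n --> \oo] -->
    (\int[mu]_(x in \bigcup_n A n) (f x)%:E)%E.
  apply: ge0_nondecreasing_set_cvg_integral => //.
  - move=> m n mn; rewrite subsetEset; apply: subset_itvr.
    by rewrite bnd_simp lef_pV2 ?posrE// ler_nat.
  - move=> n; apply/measurable_EFinP; exact: measurable_funS (AU n) mf.
  - by move=> n x /AU; rewrite /= in_itv/= andbT lee_fin => /f0.
rewrite UA; under eq_fun do rewrite intA.
move=> cvg1; apply: (cvg_unique _ cvg1) => //.
apply: cvg_EFin; first exact: nearW.
rewrite -[X in _ --> X]subr0; apply: cvgB; first exact: cvg_cst.
apply: ((cvg_at_rightP _ _ _).1 F0 harmonic); split=> [|]//.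
  by move=> n; rewrite harmonic_gt0.
exact: (@cvg_harmonic R).
Qed.

(* [p * dom p] is the derivative of the bounded increasing function
   [y |-> 1 - 1 / (1 + y^p)], hence integrable; it dominates the integrand of
   [varphi] and all its derivatives, locally uniformly in [x]. *)
Definition dom (p y : R) : R := y `^ (p - 1) / (1 + y `^ p) ^+ 2.

Lemma dom_ge0 p y : 0 <= dom p y.
Proof. by rewrite divr_ge0 ?powR_ge0// sqr_ge0. Qed.

Lemma powR_continuous (p y : R) : 0 < y -> {for y, continuous (@powR R ^~ p)}.
Proof.
move=> y0; apply/differentiable_continuous/derivable1_diffP.
by have [] := is_derive1_powR p y0.
Qed.


Lemma is_derive_dom (p y : R) : 0 < y ->
  is_derive y 1 (fun y => 1 - (1 + y `^ p)^-1) (p * dom p y).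
Proof.
move=> y0.
have h : 1 + y `^ p != 0 by rewrite gt_eqF// ltr_wpDr// powR_ge0.
have dg : is_derive y 1 (fun y : R => 1 + y `^ p) (p * y `^ (p - 1)).
  have H := (is_deriveD (is_derive_cst (1:R) (y:R) 1) (is_derive1_powR p y0)).
apply: (is_derive_ext _ _ H).
    by [].
  by rewrite add0r.
have dV := is_deriveB (is_derive_cst (1 : R) (y : R) 1)
  (is_deriveV (f := fun y => 1 + y `^ p) h dg).
apply: is_derive_ext dV => //.
rewrite /dom sub0r -[_ *: _]/(_ * _) mulNr opprK.
by rewrite mulrC -mulrA.
Qed.

Lemma powR_cvgy (p : R) : 0 < p -> y `^ p @[y --> +oo] --> +oo.
Proof.
move=> p0; apply/cvgryPge => A.
have A0 : 0 <= Num.max A 0 by rewrite le_max lexx orbT.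
apply: filterS (nbhs_pinfty_ge (num_real (Num.max A 0 `^ p^-1))) => y Ay.
apply: (@le_trans _ _ (Num.max A 0)); first by rewrite le_max lexx.
rewrite -[leLHS]powRr1// -(mulVf (lt0r_neq0 p0)) powRrM.
have B0 : 0 <= Num.max A 0 `^ p^-1 by exact: powR_ge0.
apply: ge0_ler_powR => //; first exact: ltW.
by rewrite nnegrE (le_trans B0).
Qed.

Lemma dom_continuous (p y : R) : 0 < y -> {for y, continuous (dom p)}.
Proof.
move=> y0; apply: cvgM; first exact: powR_continuous.
apply: cvgV; first by rewrite expf_neq0// gt_eqF// ltr_wpDr// powR_ge0.
by apply: cvgM; (apply: cvgD; first exact: cvg_cst); exact: powR_continuous.
Qed.

Lemma cvgy_inv1DpowR p : 0 < p -> (1 + y `^ p)^-1 @[y --> +oo] --> (0 : R).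
Proof.
move=> p0; apply/gtr0_cvgV0.
  by apply: nearW => y; rewrite ltr_wpDr// powR_ge0.
apply/cvgryPge => A; apply: filterS ((cvgryPge _).1 (powR_cvgy p0) A) => y.
by move/le_trans; apply; rewrite lerDr.
Qed.

Lemma integral_dom (p : R) : 0 < p ->
  (\int[mu]_(y in `]0%R, +oo[) (p * dom p y)%:E = 1%:E)%E.
Proof.
move=> p0; apply: (ge0_FTC_0y _ _ (@is_derive_dom p)).
- by move=> y _; rewrite mulr_ge0 ?dom_ge0// ltW.
- by move=> y y0; apply: cvgM; [exact: cvg_cst|exact: dom_continuous].
- rewrite [X in _ --> X](_ : _ = 1 - (1 + 0)^-1); last first.
    by rewrite addr0 invr1 subrr.
  apply: cvgB; first exact: cvg_cst.
  apply: cvgV; first by rewrite addr0 oner_neq0.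
  apply: cvgD; [exact: cvg_cst|exact: powR_cvg0].
- rewrite -[X in _ --> X]subr0.
  by apply: cvgB; [exact: cvg_cst|exact: cvgy_inv1DpowR].
Qed.

Lemma integrable_dom (p : R) : 0 < p -> mu.-integrable `]0, +oo[ (EFin \o dom p).
Proof.
move=> p0; apply/integrableP; split.
  by apply/measurable_EFinP; apply: measurable_fun_0y => y; exact: dom_continuous.
have -> : (fun y => `|(EFin \o dom p) y|%E) =
          (fun y => (p^-1)%:E * (p * dom p y)%:E)%E.
  apply/funext => y /=.
  by rewrite ger0_norm ?dom_ge0// -EFinM mulKf// gt_eqF.
rewrite ge0_integralZl//.
- by rewrite integral_dom// mule1 ltry.
- apply/measurable_EFinP/measurable_funM; first exact: measurable_cst.
  by apply: measurable_fun_0y => y; exact: dom_continuous.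
- by move=> y _; rewrite lee_fin mulr_ge0 ?dom_ge0// ltW.
- by rewrite lee_fin invr_ge0 ltW.
Qed.

(* For [a = - 2 lambda] and [k = 0] this is the integrand of [varphi]. *)
Definition ker (a : R) (k : nat) (x y : R) : R :=
  y `^ a * y ^+ k * expR (- ((y - x) ^+ 2 / 2)).

Lemma ker_ge0 a k x y : 0 <= y -> 0 <= ker a k x y.
Proof. by move=> y0; rewrite !mulr_ge0 ?powR_ge0 ?expR_ge0 ?exprn_ge0. Qed.

Lemma is_derive_gauss x y :
  is_derive x 1 (fun x : R => expR (- ((y - x) ^+ 2 / 2)))
    ((y - x) * expR (- ((y - x) ^+ 2 / 2))).
Proof.
have d1 := is_deriveB (is_derive_cst (y : R) (x : R) 1) (is_derive_id (x : R) 1).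
have d2 := is_deriveZ (- 2^-1 : R) (is_deriveX 2 d1).
have d3 := is_derive1_comp (is_derive_expR _) d2.
apply: is_derive_ext d3 => [t/=|/=].
  by rewrite !fctE -[_ *: _]/(_ * _) mulNr mulrC.
rewrite !fctE /GRing.scale/= [RHS]mulrC; congr (expR _ * _).
  by rewrite mulNr mulrC.
by field.
Qed.

Lemma is_derive_ker a k x y :
  is_derive x 1 (ker a k ^~ y) (ker a k.+1 x y - x * ker a k x y).
Proof.
have d := is_deriveZ (y `^ a * y ^+ k) (is_derive_gauss x y).
apply: is_derive_ext d => [t//|].
rewrite /ker (exprSr y k) /GRing.scale/=.
ring.
Qed.

(** As [y^p <= 1 + y], the polynomial part is at most [(2 + y)^(k+2)], hence at most
    [(k+2)! exp(2 + y)], which the Gaussian absorbs. [C] depends on [x] through [M] only, as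
    domination under the integral sign requires. *)
Lemma ker_le_dom (p : R) k (M : R) : 0 < p < 1 -> exists2 C : R, 0 <= C &
  forall x y, `|x| <= M -> 0 < y -> ker (p - 1) k x y <= C * dom p y.
Proof.
move=> /andP[p0 p1].
exists ((k.+2)`!%:R * expR (M + 2 + 2^-1)); first by rewrite mulr_ge0// expR_ge0.
move=> x y xM y0.
have yp0 : 0 <= y `^ p by exact: powR_ge0.
have h : 0 < (1 + y `^ p) ^+ 2 by rewrite exprn_gt0// ltr_wpDr.
have yp : y `^ p <= 1 + y.
  have [y1|y1] := leP y 1.
    rewrite -[leLHS]addr0 lerD ?(ltW y0)//.
    rewrite -[X in _ <= X](_ : 1 `^ p = 1); last by rewrite powR1.
    by apply: ge0_ler_powR; rewrite ?nnegrE ?(ltW p0) ?(ltW y0).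
  by rewrite (le_trans (ler1_powR (ltW y1) (ltW p1)))// lerDr.
have poly : y ^+ k * (1 + y `^ p) ^+ 2 <= (k.+2)`!%:R * expR (2 + y).
  have y20 : 0 <= 2 + y by rewrite addr_ge0// ltW.
  rewrite mulrC -ler_pdivrMl ?ltr0n ?fact_gt0//.
  have e : (2 + y) ^+ k.+2 / (k.+2)`!%:R <= expR (2 + y).
    by apply: le_trans (expR_ge1Dxn k.+1 y20); rewrite lerDr.
  apply: le_trans e.
  rewrite [leRHS]mulrC ler_pM2l ?invr_gt0 ?ltr0n ?fact_gt0//.
  rewrite -(addn2 k) (exprD _ k) mulrC ler_pM ?exprn_ge0//.
  - exact: ltW.
  - by rewrite addr_ge0.
  - by apply: lerXn2r; rewrite ?nnegrE ?(ltW y0)// lerDr.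
  - by apply: lerXn2r; rewrite ?nnegrE ?addr_ge0//; lra.
(* Completing the square: with [t = y - x], [t - t^2 / 2 <= 1/2]; this is the [2^-1] in the
   constant. *)
have expb : expR (2 + y) * expR (- ((y - x) ^+ 2 / 2)) <= expR (M + 2 + 2^-1).
  rewrite -expRD ler_expR.
  have /ler_normlP[xM1 xM2] := xM.
  have := sqr_ge0 (y - x - 1); lra.
rewrite /ker /dom mulrA ler_pdivlMr//.
set E := expR (- _) in expb *.
rewrite [leLHS](_ : _ = y `^ (p - 1) * (y ^+ k * (1 + y `^ p) ^+ 2 * E)); last by ring.
rewrite [leRHS]mulrC ler_wpM2l ?powR_ge0//.
apply: le_trans (ler_wpM2r (expR_ge0 _) poly) _.
by rewrite -mulrA ler_wpM2l.
Qed.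

Lemma ker_continuous a k x y : 0 < y -> {for y, continuous (ker a k x)}.
Proof.
move=> y0; apply: cvgM.
  by apply: cvgM; [exact: powR_continuous|exact: exprn_continuous].
apply: continuous_comp; last exact: continuous_expR.
apply: cvgN; apply: cvgM; last exact: cvg_cst.
by apply: cvgM; (apply: cvgB; [exact: cvg_id|exact: cvg_cst]).
Qed.

Lemma integrable_ker a k x : -1 < a < 0 ->
  mu.-integrable `]0, +oo[ (EFin \o ker a k x).
Proof.
move=> /andP[a1 a0].
have p01 : 0 < a + 1 < 1 by apply/andP; split; lra.
have [C C0 CP] := ker_le_dom k `|x| p01.
have mB : measurable (`]0%R, +oo[%classic : set (measurableTypeR R)) by exact: measurable_itv.
have [p0 _] := andP p01.
have := integrableZl mB C (integrable_dom p0).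
apply: le_integrable => //.
- by apply/measurable_EFinP; apply: measurable_fun_0y => y; exact: ker_continuous.
- move=> y /=; rewrite in_itv/= andbT => y0; rewrite lee_fin.
  rewrite (ger0_norm (ker_ge0 _ _ _ (ltW y0))) (ger0_norm (mulr_ge0 C0 (dom_ge0 _ _))).
  by have := CP x y (lexx _) y0; rewrite addrK.
Qed.

(** Differentiation in [x] brings down a factor [y - x], so [varphi] and its first two derivatives
    are combinations of the moments with [k] = 0, 1, 2. *)
Definition moment a k x : R := \int[mu]_(y in `]0, +oo[) ker a k x y.

Lemma is_derive_moment a k x : -1 < a < 0 ->
  is_derive x 1 (moment a k) (moment a k.+1 x - x * moment a k x).
Proof.
move=> ha; have /andP[a1 a0] := ha.
have p01 : 0 < a + 1 < 1 by apply/andP; split; lra.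
have [C0 C00 CP0] := ker_le_dom k (`|x| + 1) p01.
have [C1 C10 CP1] := ker_le_dom k.+1 (`|x| + 1) p01.
have Ix : `](x - 1), (x + 1)[%classic x by rewrite /= in_itv/=; apply/andP; split; lra.
(* For [z] within distance 1 of [x], the derivative [ker a k.+1 z y - z * ker a k z y] is bounded by
   [C * dom (a + 1) y]. *)
pose C := C1 + (`|x| + 1) * C0.
have CC : 0 <= C by rewrite addr_ge0// mulr_ge0// addr_ge0.
pose B : set (measurableTypeR R) := `]0%R, +oo[%classic.
have mB : measurable B by exact: measurable_itv.
have d1E z y : partial1of2 (ker a k) z y = ker a k.+1 z y - z * ker a k z y.
  by rewrite partial1of2E; apply: derive_val; exact: is_derive_ker.
have intf z : mu.-integrable B (EFin \o ker a k z) by exact: integrable_ker.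
have derf z y : `](x - 1), (x + 1)[%classic z -> B y -> derivable (ker a k ^~ y) z 1.
  by move=> _ _; have [] := is_derive_ker a k z y.
have G0 y : 0 <= C * dom (a + 1) y by rewrite mulr_ge0// dom_ge0.
have intG : mu.-integrable B (EFin \o (fun y => C * dom (a + 1) y)).
  have [p0 _] := andP p01.
  have := integrableZl mB C (integrable_dom p0).
  by apply: eq_integrable.
have Gub z y : `](x - 1), (x + 1)[%classic z -> B y ->
    `|partial1of2 (ker a k) z y| <= C * dom (a + 1) y.
  rewrite /= /B/= !in_itv/= andbT => /andP[z1 z2] y0; rewrite d1E.
  have zx : `|z| <= `|x| + 1.
    have : `|z - x| <= 1 by apply/ler_normlP; split; lra.
    by have := ler_normD x (z - x); rewrite addrC subrK => h1 h2; lra.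
  have := CP0 z y zx y0; have := CP1 z y zx y0; rewrite addrK => h1 h0.
  rewrite (le_trans (ler_normB _ _))// [`|z * _|]normrM !(ger0_norm (ker_ge0 _ _ _ (ltW y0))).
  rewrite /C mulrDl lerD// -mulrA ler_pM ?ker_ge0// ltW//.
have DD := derivable_under_integral mB Ix (fun z _ => intf z) derf G0 intG Gub.
split; first exact: DD.
rewrite -derive1E (differentiation_under_integral mB Ix (fun z _ => intf z) derf G0 intG Gub).
under eq_Rintegral do rewrite d1E.
rewrite RintegralB ?RintegralZl//.
  exact: integrable_ker.
by have := integrableZl mB x (intf x); apply: eq_integrable.
Qed.

Lemma is_derive_gauss_antisym x y :
  is_derive y 1 (fun y : R => expR (- ((y - x) ^+ 2 / 2)))
    (- ((y - x) * expR (- ((y - x) ^+ 2 / 2)))).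
Proof.
apply: is_derive_ext (is_derive_gauss y x) => [t|].
  by rewrite -(sqrrN (x - t)) opprB.
rewrite -[RHS]mulNr opprB; congr (_ * expR _).
by field.
Qed.

(* Integration by parts; a multiple of [dom] makes the integrand of
   (y^(a+1) exp(-(y-x)^2/2))' nonnegative. *)
Lemma moment_rec a x : -1 < a < 0 -> (a + 1) * moment a 0 x = moment a 2 x - x * moment a 1 x.
Proof.
move=> ha; have /andP[a1 a0] := ha.
have p01 : 0 < a + 1 < 1 by apply/andP; split; lra.
have [p0 p1] := andP p01.
have [C0 C00 CP0] := ker_le_dom 0 `|x| p01.
have [C1 C10 CP1] := ker_le_dom 1 `|x| p01.
have [C2 C20 CP2] := ker_le_dom 2 `|x| p01.
pose B : set (measurableTypeR R) := `]0%R, +oo[%classic.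
have mB : measurable B by exact: measurable_itv.
pose K := ((a + 1) * C0 + C2 + `|x| * C1) / (a + 1).
pose F y := y `^ (a + 1) * expR (- ((y - x) ^+ 2 / 2)).
pose dF y := (a + 1) * ker a 0 x y - ker a 2 x y + x * ker a 1 x y.
pose H y := F y + K * (1 - (1 + y `^ (a + 1))^-1).
pose dH y := dF y + K * ((a + 1) * dom (a + 1) y).
have pa y : 0 < y -> y `^ (a + 1) = y `^ a * y.
  by move=> y0; rewrite powRD ?powRr1 ?(ltW y0)// (gt_eqF y0) implybT.
have dFP y : 0 < y -> is_derive y 1 F (dF y).
  move=> y0.
  have := is_deriveM (is_derive1_powR (a + 1) y0) (is_derive_gauss_antisym x y).
  move=> d; apply: is_derive_ext d => //.
  rewrite /dF /ker pa// addrK /GRing.scale/= expr1 expr0; ring.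
have dHP y : 0 < y -> is_derive y 1 H (dH y).
  move=> y0; have d := is_deriveD (dFP y y0) (is_deriveZ K (is_derive_dom (a + 1) y0)).
  by apply: is_derive_ext d.
(* [F] tends to 0 at both ends, so only the auxiliary term contributes, with total increment [K].
   Cancelling [K] at the end leaves a zero integral for [dF], which is the claim. *)
have intH : (\int[mu]_(y in `]0%R, +oo[) (dH y)%:E = K%:E)%E.
  apply: (ge0_FTC_0y _ _ dHP).
  - move=> y y0.
    have := CP0 x y (lexx _) y0; have := CP1 x y (lexx _) y0.
    have := CP2 x y (lexx _) y0; rewrite addrK => h2 h1 h0.
    have -> : dH y = dF y + (((a + 1) * C0 + C2 + `|x| * C1)) * dom (a + 1) y.
      by rewrite /dH mulrA divfK// gt_eqF.
    have := ker_ge0 a 0 x (ltW y0); have := ker_ge0 a 1 x (ltW y0) => k1 k0.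
    have : - (`|x| * (C1 * dom (a + 1) y)) <= x * ker a 1 x y.
      have : 0 <= (`|x| + x) * ker a 1 x y.
        by rewrite mulr_ge0// -lerBlDr sub0r -normrN ler_norm.
      have : `|x| * ker a 1 x y <= `|x| * (C1 * dom (a + 1) y) by rewrite ler_wpM2l.
      lra.
    have : 0 <= (a + 1) * ker a 0 x y by rewrite mulr_ge0// ltW.
    have : 0 <= (a + 1) * (C0 * dom (a + 1) y) by rewrite mulr_ge0 ?(ltW p0)// mulr_ge0// dom_ge0.
    rewrite /dF; lra.
  - move=> y y0; apply: cvgD; last first.
      by apply: cvgM; [exact: cvg_cst|apply: cvgM; [exact: cvg_cst|exact: dom_continuous]].
    apply: cvgD; last by apply: cvgM; [exact: cvg_cst|exact: ker_continuous].
    apply: cvgB; last exact: ker_continuous.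
    by apply: cvgM; [exact: cvg_cst|exact: ker_continuous].
  - rewrite [X in _ --> X](_ : _ =
        0 * expR (- ((0 - x) ^+ 2 / 2)) + K * (1 - (1 + 0)^-1)); last first.
      by rewrite addr0 invr1 subrr mul0r mulr0 addr0.
    apply: cvgD; apply: cvgM.
    + exact: powR_cvg0.
    + have cg : {for (0 : R), continuous (fun y : R => expR (- ((y - x) ^+ 2 / 2)))}.
        apply/differentiable_continuous/derivable1_diffP.
        by have [] := is_derive_gauss_antisym x 0.
      exact: cvg_at_right_filter cg.
    + exact: cvg_cst.
    + apply: cvgB; first exact: cvg_cst.
      apply: cvgV; first by rewrite addr0 oner_neq0.
      apply: cvgD; [exact: cvg_cst|exact: powR_cvg0].
  - rewrite [X in _ --> X](_ : _ = 0 + K * (1 - 0)); last first.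
      by rewrite subr0 mulr1 add0r.
    apply: cvgD; last first.
      apply: cvgM; first exact: cvg_cst.
      by apply: cvgB; [exact: cvg_cst|exact: cvgy_inv1DpowR].
    (* Since [F y = ker a 1 x y <= C1 * dom (a + 1) y <= C1 * y^a] and [a < 0], this bound squeezes
       [F] to 0. *)
    have cv : C1 * (y `^ (- a))^-1 @[y --> +oo] --> (0 : R).
      rewrite -[X in _ --> X](mulr0 C1); apply: cvgM; first exact: cvg_cst.
      apply/gtr0_cvgV0; last by apply: powR_cvgy; lra.
      by apply: filterS (nbhs_pinfty_gt (num_real 0)) => y; exact: powR_gt0.
    apply: (squeeze_cvgr _ (cvg_cst 0) cv).
    apply: filterS (nbhs_pinfty_gt (num_real 0)) => y y0.
    have -> : F y = ker a 1 x y by rewrite /F pa// /ker expr1.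
    rewrite ker_ge0 ?(ltW y0)//= -powRN opprK.
    have := CP1 x y (lexx _) y0; rewrite addrK => /le_trans; apply.
    rewrite ler_wpM2l// /dom addrK ler_pdivrMr ?exprn_gt0 ?ltr_wpDr ?powR_ge0//.
    by rewrite ler_peMr ?powR_ge0// exprn_ege1// lerDl powR_ge0.
have iker k : mu.-integrable B (EFin \o ker a k x) by exact: integrable_ker.
have iZ (c : R) (f : R -> R) : mu.-integrable B (EFin \o f) ->
    mu.-integrable B (EFin \o (fun y => c * f y)).
  by move=> intf; have := integrableZl mB c intf; apply: eq_integrable.
have iD (g f : R -> R) : mu.-integrable B (EFin \o f) -> mu.-integrable B (EFin \o g) ->
    mu.-integrable B (EFin \o (fun y => f y + g y)).
  by move=> intf intg; have := integrableD mB intf intg; apply: eq_integrable.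
have iB (g f : R -> R) : mu.-integrable B (EFin \o f) -> mu.-integrable B (EFin \o g) ->
    mu.-integrable B (EFin \o (fun y => f y - g y)).
  by move=> intf intg; have := integrableB mB intf intg; apply: eq_integrable.
have idom := integrable_dom p0.
have : \int[mu]_(y in B) dH y = K by rewrite /Rintegral intH.
rewrite RintegralD//; last 2 first.
- by apply: iD; [apply: iB => //|]; exact: iZ.
- by apply/iZ/iZ.
rewrite RintegralD//; last 2 first.
- by apply: iB => //; exact: iZ.
- exact: iZ.
rewrite RintegralB//; last exact: iZ.
rewrite !RintegralZl//; last exact: iZ.
have -> : (a + 1) * \int[mu]_(y in B) dom (a + 1) y = 1.
  by rewrite -RintegralZl// /Rintegral integral_dom.
rewrite -!/(moment _ _ _); lra.
Qed.

Definition dvarphi l x : R := moment (- (2 * l)) 1 x - x * varphi l x.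

Lemma varphiE l : varphi l = moment (- (2 * l)) 0.
Proof.
apply/funext => x; apply: eq_Rintegral => y _.
by rewrite /ker expr0 mulr1.
Qed.

(** * Differential equation, positivity and Gaussian decay of [varphi] *)

Section Varphi.
Variable l : R.
Hypothesis l_int : 0 < l < 2^-1.

Let hl : -1 < - (2 * l) < 0.
Proof. by move: l_int => /andP[l0 l1]; apply/andP; split; lra. Qed.

Lemma is_derive_varphi x : is_derive x 1 (varphi l) (dvarphi l x).
Proof. by rewrite /dvarphi varphiE; exact: is_derive_moment. Qed.

(** This is the equation [phi'' + x phi' + 2 l phi = 0]: differentiating [dvarphi] produces the
    second moment, which [moment_rec] with [a = - 2 l] eliminates. *)
Lemma is_derive_dvarphi x :
  is_derive x 1 (dvarphi l) (- (2 * l) * varphi l x - x * dvarphi l x).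
Proof.
have d := is_deriveB (is_derive_moment 1 x hl)
  (is_deriveM (is_derive_id (x : R) 1) (is_derive_varphi x)).
apply: is_derive_ext d => [//|].
have := moment_rec x hl; rewrite -varphiE /dvarphi /GRing.scale/= => h.
lra.
Qed.

Lemma varphi''E x : varphi'' l x = - (2 * l) * varphi l x - x * dvarphi l x.
Proof.
have -> : varphi'' l = derive1 (dvarphi l).
  rewrite /varphi'' /derive1n/=; congr derive1; apply/funext => z.
  by rewrite derive1E; have [] := is_derive_varphi z.
by rewrite derive1E; have [] := is_derive_dvarphi x.
Qed.

Lemma varphi_gt0 x : 0 < varphi l x.
Proof.
rewrite varphiE; set a := - (2 * l).
(* Lower bound of the integrand on [[1, 2]], where [y^a >= 2^a] because [a < 0], and
   [|y - x| <= |x| + 2]. *)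
pose c := 2 `^ a * expR (- ((`|x| + 2) ^+ 2 / 2)).
have c0 : 0 < c by rewrite mulr_gt0 ?powR_gt0 ?expR_gt0.
pose B : set (measurableTypeR R) := `]0%R, +oo[%classic.
pose D : set (measurableTypeR R) := `[1%R, 2%R]%classic.
have mB : measurable B by exact: measurable_itv.
have mD : measurable D by exact: measurable_itv.
have iker : mu.-integrable B (EFin \o ker a 0 x) by exact: integrable_ker.
rewrite -lte_fin /moment /Rintegral fineK; last exact: integrable_fin_num.
apply: (@lt_le_trans _ _ (\int[mu]_(y in D) cst c%:E y)%E).
  rewrite integral_cst//=; rewrite lebesgue_measure_itv/= lte_fin ltr1n/=.
  by rewrite -EFinB -EFinM lte_fin mulr_gt0//; lra.
apply: (@le_trans _ _ (\int[mu]_(y in D) (ker a 0 x y)%:E)%E).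
  apply: ge0_le_integral => //.
  - by move=> y _; rewrite lee_fin ltW.
  - have /integrableP[mk _] := iker; apply: measurable_funS mk => //.
    by move=> y; rewrite /D /B/= !in_itv/= andbT => /andP[y1 _]; apply: lt_le_trans y1.
  - move=> y; rewrite /D/= in_itv/= => /andP[y1 y2]; rewrite lee_fin /ker expr0 mulr1.
    have y0 : 0 < y by apply: lt_le_trans y1.
    apply: ler_pM; rewrite ?powR_ge0 ?expR_ge0//.
      rewrite -(opprK a) !(powRN _ (- a)) lef_pV2 ?posrE ?powR_gt0//.
      apply: ge0_ler_powR; rewrite ?nnegrE ?(ltW y0)// oppr_ge0 ltW//.
      by case/andP: hl.
    rewrite ler_expR lerN2 ler_pM2r ?invr_gt0//.
    have := ler_norm x; have := ler_norm (- x); rewrite normrN => h1 h2.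
    have : 0 <= (`|x| + 2 - (y - x)) * (`|x| + 2 + (y - x)) by apply: mulr_ge0; lra.
    by lra.
apply: ge0_subset_integral => //.
- by have /integrableP[] := iker.
- by move=> y; rewrite /B/= in_itv/= andbT => y0; rewrite lee_fin ker_ge0// ltW.
- by move=> y; rewrite /D /B/= !in_itv/= andbT => /andP[y1 _]; apply: lt_le_trans y1.
Qed.

(** For [x, y >= 0], [(y + x)^2 >= y^2 + x^2], so the factor [exp(-x^2/2)] comes out of the
    integral. The Gaussian bound on the profile originates here. *)
Lemma varphi_le_gauss x : 0 <= x ->
  varphi l (- x) <= expR (- (x ^+ 2 / 2)) * varphi l 0.
Proof.
move=> x0; rewrite varphiE; set a := - (2 * l).
pose B : set (measurableTypeR R) := `]0%R, +oo[%classic.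
have mB : measurable B by exact: measurable_itv.
have iker z : mu.-integrable B (EFin \o ker a 0 z) by exact: integrable_ker.
rewrite /moment -RintegralZl//; apply: le_Rintegral => //.
  by have := integrableZl mB (expR (- (x ^+ 2 / 2))) (iker 0); apply: eq_integrable.
move=> y; rewrite /= in_itv/= andbT => y0.
rewrite /ker mulrCA ler_wpM2l ?mulr_ge0 ?powR_ge0 ?expr0// -expRD ler_expR.
have : 0 <= x * y by rewrite mulr_ge0// ltW.
lra.
Qed.

End Varphi.

End Kernel.

(** * The self-similar profile *)

Section Profile.
Context {R : realType}.
Implicit Types (f : R -> R) (x y c l : R).

Lemma is_derive_scale f f1 c : (forall y, is_derive y 1 f (f1 y)) ->
  forall y, is_derive y 1 (fun y => f (c * y)) (c * f1 (c * y)).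
Proof.
move=> df y.
have d := is_derive1_comp (df (c * y)) (is_deriveZ c (is_derive_id (y : R) 1)).
apply: is_derive_ext d => //.
by rewrite /GRing.scale/= mulr1 mulrC.
Qed.

(** Freezing [f] to the left of [c] creates no corner when [f1 c = 0]: at [c] the difference
    quotient is either 0 or that of [f], which tends to 0. Used once for a function and once for its
    derivative, this yields C^2 gluing. *)
Lemma is_derive_trunc f f1 c : (forall y, is_derive y 1 f (f1 y)) -> f1 c = 0 ->
  forall y, is_derive y 1 (fun y => f (Num.max y c)) (f1 (Num.max y c)).
Proof.
move=> df f1c y; have [yc|cy|->] := ltgtP y c.
- rewrite f1c.
  refine (near_eq_is_derive _ (is_derive_cst (f c : R) (y : R) 1)).
  near=> z; rewrite /cst max_r// ltW//; near: z; exact: lt_nbhsl.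
- refine (near_eq_is_derive _ (df y)).
  near=> z; rewrite max_l// ltW//; near: z; exact: lt_nbhsr.
- rewrite f1c.
  have [/cvg_ex[/= L fL] fE] := df c.
  have L0 : L = 0.
    by rewrite -f1c -fE; apply/esym/cvg_lim => //; exact: fL.
  rewrite L0 in fL.
  have H : h^-1 *: (f (Num.max (h *: 1 + c) c) - f (Num.max c c)) @[h --> 0^'] --> (0 : R).
    apply/cvgr0Pnorm_le => e e0.
    have near_fL := (cvgr0Pnorm_le _).1 fL e e0.
    near=> h; have : `|h^-1 *: (f (h *: 1 + c) - f c)| <= e by near: h; exact: near_fL.
    rewrite maxxx.
    case: (leP (h *: 1 + c) c) => // _ _.
    by rewrite subrr scaler0 normr0 ltW.
  by split; [apply/cvg_ex; exists 0|apply: cvg_lim].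
Unshelve. all: end_near. Qed.

(* [G a = max (a / 2) (sigma^2 a / 2)], so a function solving the linear equation
   with either coefficient is a subsolution, whatever the sign of its second
   derivative. *)
Lemma G_ge_half (sigma a : R) : sigma ^+ 2 <= 1 -> 2^-1 * a <= G sigma a.
Proof.
move=> s1; rewrite /G ler_pM2l ?invr_gt0//.
case: (leP 0 a) => a0.
  by rewrite (max_l (_ : - a <= 0)) ?oppr_le0// mulr0 subr0.
rewrite max_r ?oppr_ge0 ?(ltW a0)// mulrN; nra.
Qed.

Lemma G_ge_half_sigma (sigma a : R) : sigma ^+ 2 <= 1 -> 2^-1 * (sigma ^+ 2 * a) <= G sigma a.
Proof.
move=> s1; rewrite /G ler_pM2l ?invr_gt0//.
case: (leP 0 a) => a0.
  by rewrite (max_l (_ : - a <= 0)) ?oppr_le0// mulr0 subr0; nra.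
rewrite max_r ?oppr_ge0 ?(ltW a0)// mulrN; nra.
Qed.

(* As [sigma <> 0], neither [x1_of l] nor [z_of l] is the default value of [xget]. *)
Lemma sigma_of_roots (sigma l : R) : 0 < sigma -> sigma_of l = sigma ->
  exists2 z : R, 0 < z & varphi'' l z + varphi'' l (- z) = 0 /\
    varphi'' l (- (sigma * z)) = 0.
Proof.
move=> s0; rewrite /sigma_of => sE.
have x1N0 : x1_of l != 0.
  by apply: contraTneq s0 => x0; rewrite -sE x0 oppr0 mul0r ltxx.
have zN0 : z_of l != 0.
  by apply: contraTneq s0 => x0; rewrite -sE x0 invr0 mulr0 ltxx.
have [x1lt x1E] : x1_of l < 0 /\ varphi'' l (x1_of l) = 0.
  move: x1N0; rewrite /x1_of; case: xgetP => [x -> //|]; by rewrite eqxx.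
have [zgt zE] : 0 < z_of l /\ varphi'' l (z_of l) + varphi'' l (- z_of l) = 0.
  move: zN0; rewrite /z_of; case: xgetP => [x -> //|]; by rewrite eqxx.
exists (z_of l); first exact: zgt.
split; first exact: zE.
by rewrite -sE divfK ?opprK.
Qed.

(* The profile is [P (phi (y / sigma) + phi (- y / sigma))] for [|y| <= sigma z]
   and [Q phi (- |y|)] beyond. The constants make the values match, the choice of
   [z] makes both second derivatives vanish at the junction, and the two
   differential equations then force the first derivatives to agree. *)
Lemma glued_profile (sigma l z : R) (phi phi1 phi2 : R -> R) :
  0 < sigma < 1 -> 0 < l -> 0 < z ->
  (forall x, is_derive x 1 phi (phi1 x)) -> (forall x, is_derive x 1 phi1 (phi2 x)) ->
  (forall x, phi2 x = - (2 * l) * phi x - x * phi1 x) ->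
  (forall x, 0 < phi x) ->
  (forall x, 0 <= x -> phi (- x) <= expR (- (x ^+ 2 / 2)) * phi 0) ->
  phi2 z + phi2 (- z) = 0 -> phi2 (- (sigma * z)) = 0 ->
  exists f f1 f2 : R -> R,
  [/\ forall y, is_derive y 1 f (f1 y), forall y, is_derive y 1 f1 (f2 y),
     continuous f2, forall y, - l * f y - 2^-1 * y * f1 y <= G sigma (f2 y) &
     0 < f 0 /\ exists2 B, 0 < B & forall y, f y <= B * expR (- (y ^+ 2 / 2))].
Proof.
move=> /andP[s0 s1] l0 z0 dphi dphi1 phi2E phi0 phi_gauss zE xE.
have s2 : sigma ^+ 2 <= 1 by rewrite expr_le1// ltW.
have [s ss] : exists s, s * sigma = 1 by exists sigma^-1; rewrite mulVf// gt_eqF.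
pose y0 := sigma * z; have y00 : 0 < y0 by rewrite mulr_gt0.
rewrite -/y0 in xE.
(* Each branch is multiplied by the value of the other at the junction, so both equal [P * Q] there
   without any division. *)
pose Q := phi z + phi (- z); pose P := phi (- y0).
have Q0 : 0 < Q by rewrite addr_gt0.
pose k y := Q * phi (- 1 * y); pose k1 y := Q * (- 1 * phi1 (- 1 * y)).
pose k2 y := Q * (- 1 * (- 1 * phi2 (- 1 * y))).
pose g y := P * (phi (s * y) + phi (- s * y)).
pose g1 y := P * (s * phi1 (s * y) + - s * phi1 (- s * y)).
pose g2 y := P * (s * (s * phi2 (s * y)) + - s * (- s * phi2 (- s * y))).
have isM (f : R -> R) (c y t : R) :
    is_derive y 1 f t -> is_derive y 1 (fun y => c * f y) (c * t).
  move=> d; have dc := is_deriveZ c d.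
  by apply: is_derive_ext dc.
have dk y : is_derive y 1 k (k1 y).
  exact: (isM _ Q _ _ (is_derive_scale (- 1) dphi y)).
have dk1 y : is_derive y 1 k1 (k2 y).
  exact: (isM _ Q _ _ (isM _ (- 1) _ _ (is_derive_scale (- 1) dphi1 y))).
have dg y : is_derive y 1 g (g1 y).
  pose h y := phi (s * y) + phi (- s * y).
  pose h1 y := s * phi1 (s * y) + - s * phi1 (- s * y).
  have d := is_deriveD (is_derive_scale s dphi y) (is_derive_scale (- s) dphi y).
  have dh : is_derive y 1 h (h1 y) by apply: is_derive_ext d.
  exact: (isM _ P _ _ dh).
have dg1 y : is_derive y 1 g1 (g2 y).
  pose h y := s * phi1 (s * y) + - s * phi1 (- s * y).
  pose h1 y := s * (s * phi2 (s * y)) + - s * (- s * phi2 (- s * y)).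
  have d := is_deriveD (isM _ s _ _ (is_derive_scale s dphi1 y))
    (isM _ (- s) _ _ (is_derive_scale (- s) dphi1 y)).
  have dh : is_derive y 1 h (h1 y) by apply: is_derive_ext d.
  exact: (isM _ P _ _ dh).
have kODE y : k2 y + y * k1 y + 2 * l * k y = 0 by rewrite /k2 /k1 /k phi2E; ring.
have gODE y : sigma ^+ 2 * g2 y + y * g1 y + 2 * l * g y = 0.
  have E : sigma ^+ 2 * g2 y = P * (phi2 (s * y) + phi2 (- s * y)).
    rewrite /g2; transitivity
      (P * ((s * sigma) ^+ 2 * phi2 (s * y) + (s * sigma) ^+ 2 * phi2 (- s * y))).
      by move: (phi2 (s * y)) (phi2 (- s * y)) => A B; ring.
    by rewrite ss expr1n !mul1r.
  by rewrite E /g1 /g !phi2E; ring.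
have sy0 : s * y0 = z by rewrite /y0 mulrA ss mul1r.
have d0 : k y0 = g y0.
  by rewrite /k /g mulN1r mulNr sy0 mulrC.
have k20 : k2 y0 = 0 by rewrite /k2 (mulN1r y0) xE !mulr0.
have g20 : g2 y0 = 0.
  rewrite /g2 (mulNr s y0) sy0; transitivity (P * (s ^+ 2 * (phi2 z + phi2 (- z)))).
    by ring.
  by rewrite zE !mulr0.
have d10 : k1 y0 = g1 y0.
  have := kODE y0; have := gODE y0; rewrite k20 g20 d0 mulr0 !add0r => h1 h2.
  by apply: (mulfI (lt0r_neq0 y00)); lra.
pose d y := k y - g y; pose d1 y := k1 y - g1 y; pose d2 y := k2 y - g2 y.
have dd y : is_derive y 1 d (d1 y) by apply: is_derive_ext (is_deriveB (dk y) (dg y)).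
have dd1 y : is_derive y 1 d1 (d2 y) by apply: is_derive_ext (is_deriveB (dk1 y) (dg1 y)).
have d_0 : d y0 = 0 by rewrite /d d0 subrr.
have d1_0 : d1 y0 = 0 by rewrite /d1 d10 subrr.
have d2_0 : d2 y0 = 0 by rewrite /d2 k20 g20 subrr.
(* The correction [e] is 0 up to [y0] and [k - g] beyond. Adding it and its mirror image to the even
   function [g] gives the glued profile by one formula, even and twice differentiable on the whole
   line. *)
pose e y := d (Num.max y y0); pose e1 y := d1 (Num.max y y0).
pose e2 y := d2 (Num.max y y0).
have de y : is_derive y 1 e (e1 y) by exact: (is_derive_trunc dd d1_0).
have de1 y : is_derive y 1 e1 (e2 y) by exact: (is_derive_trunc dd1 d2_0).
pose f y := g y + e y + e (- 1 * y).
pose f1 y := g1 y + e1 y + - 1 * e1 (- 1 * y).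
pose f2 y := g2 y + e2 y + - 1 * (- 1 * e2 (- 1 * y)).
have f_odd : [/\ forall y, f (- y) = f y, forall y, f1 (- y) = - f1 y &
    forall y, f2 (- y) = f2 y].
  split=> y; rewrite /f /f1 /f2 !mulN1r ?opprK.
  - by rewrite addrAC; congr (_ + _ + _); rewrite /g !mulrN !mulNr opprK addrC.
  - by rewrite /g1 !mulrN !mulNr opprK; ring.
  - rewrite addrAC; congr (_ + _ + _).
    by rewrite /g2 !(mulrN, mulNr, opprK) addrC.
have [f_even f1_odd f2_even] := f_odd.
have f_in y : 0 <= y <= y0 -> [/\ f y = g y, f1 y = g1 y & f2 y = g2 y].
  move=> /andP[y_ge0 yy0].
  have Nyy0 : - 1 * y <= y0 by lra.
  by rewrite /f /f1 /f2 /e /e1 /e2 !max_r// d_0 d1_0 d2_0 !mulr0 !addr0.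
have f_out y : y0 <= y -> [/\ f y = k y, f1 y = k1 y & f2 y = k2 y].
  move=> yy0; have Nyy0 : - 1 * y <= y0 by lra.
  rewrite /f /f1 /f2 /e /e1 /e2 (max_l yy0) (max_r Nyy0) d_0 d1_0 d2_0 !mulr0 !addr0.
  by rewrite /d /d1 /d2 ![_ + (_ - _)]addrC !subrK.
have cphi2 : continuous phi2.
  rewrite (funext phi2E : phi2 = _) => x.
  apply: cvgB; apply: cvgM; [exact: cvg_cst| |exact: cvg_id|].
    by apply/differentiable_continuous/derivable1_diffP; have [] := dphi x.
  by apply/differentiable_continuous/derivable1_diffP; have [] := dphi1 x.
have cphi2s (c : R) : continuous (fun y => phi2 (c * y)).
  by move=> y; apply: continuous_comp; [apply: cvgM; [exact: cvg_cst|exact: cvg_id]|exact: cphi2].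
have ck2 : continuous k2.
  by move=> y; do 3!(apply: cvgM; first exact: cvg_cst); exact: cphi2s.
have cg2 : continuous g2.
  move=> y; apply: cvgM; first exact: cvg_cst.
  by apply: cvgD; do 2!(apply: cvgM; first exact: cvg_cst); exact: cphi2s.
have ce2 : continuous e2.
  move=> y; apply: (@continuous_comp _ _ _ (fun y : R => Num.max y y0) d2).
    by apply: continuous_max; [exact: cvg_id|exact: cvg_cst].
  by apply: cvgB; [exact: ck2|exact: cg2].
exists f, f1, f2; split.
- move=> y; have d3 := is_deriveD (is_deriveD (dg y) (de y)) (is_derive_scale (- 1) de y).
  by apply: is_derive_ext d3.
- move=> y; have d3 := is_deriveD (is_deriveD (dg1 y) (de1 y))
    (isM _ (- 1) _ _ (is_derive_scale (- 1) de1 y)).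
  by apply: is_derive_ext d3.
- move=> y; apply: cvgD; first by apply: cvgD; [exact: cg2|exact: ce2].
  do 2!(apply: cvgM; first exact: cvg_cst).
  by apply: continuous_comp; [apply: cvgM; [exact: cvg_cst|exact: cvg_id]|exact: ce2].
- have sub y : 0 <= y -> - l * f y - 2^-1 * y * f1 y <= G sigma (f2 y).
    move=> y_ge0; have [yy0|yy0] := leP y0 y.
      have [-> -> ->] := f_out y yy0.
      apply: le_trans (G_ge_half _ s2).
      by have := kODE y; lra.
    have [|-> -> ->] := f_in y; first by rewrite y_ge0 ltW.
    apply: le_trans (G_ge_half_sigma _ s2).
    by have := gODE y; lra.
  move=> y; have [|y_lt0] := leP 0 y; first exact: sub.
  have := sub (- y); rewrite f_even f1_odd f2_even oppr_ge0 ltW// => /(_ isT).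
  by apply: le_trans; lra.
- split.
    have [|-> _ _] := f_in 0; first by rewrite lexx ltW.
    by rewrite /g !mulr0; apply: mulr_gt0; [exact: phi0|exact: addr_gt0].
  have cf : {within `[0, y0], continuous f}.
    apply: derivable_within_continuous => y _.
    have d3 := is_deriveD (is_deriveD (dg y) (de y)) (is_derive_scale (- 1) de y).
    by have [] := d3.
  have [c _ fc] := EVT_max (ltW y00) cf.
  (* The first summand serves [y >= y0] through the decay of [phi]; the second serves [[0, y0]],
     where [f <= f c] and the Gaussian is at least [exp(-y0^2/2)]. *)
  pose B := Q * phi 0 + `|f c| * expR (y0 ^+ 2 / 2).
  have B0 : 0 < B by rewrite ltr_wpDr ?mulr_ge0 ?expR_ge0// mulr_gt0.
  exists B => //.
  have bnd y : 0 <= y -> f y <= B * expR (- (y ^+ 2 / 2)).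
    move=> y_ge0; rewrite mulrDl; have [yy0|yy0] := leP y0 y.
      have [-> _ _] := f_out y yy0.
      rewrite ler_wpDr ?mulr_ge0 ?expR_ge0// /k mulN1r -mulrA ler_pM2l// mulrC.
      exact: phi_gauss.
    apply: ler_wpDl; first by rewrite !mulr_ge0 ?expR_ge0// ltW.
    rewrite -mulrA -expRD (le_trans (fc y _))//; first by rewrite in_itv/= y_ge0 ltW.
    rewrite (le_trans (ler_norm _))// ler_peMr// -[leLHS]expR0 ler_expR.
    have : y ^+ 2 <= y0 ^+ 2 by rewrite ler_sqr ?nnegrE ?(ltW yy0)// ltW.
    by lra.
  move=> y; have [|y_lt0] := leP 0 y; first exact: bnd.
  by have := bnd (- y); rewrite f_even sqrrN oppr_ge0 ltW// => /(_ isT).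
Qed.
Lemma profile (sigma l : R) : 0 < sigma < 1 -> 0 < l < 2^-1 -> sigma_of l = sigma ->
  exists f f1 f2 : R -> R,
  [/\ forall y, is_derive y 1 f (f1 y), forall y, is_derive y 1 f1 (f2 y),
     continuous f2, forall y, - l * f y - 2^-1 * y * f1 y <= G sigma (f2 y) &
     0 < f 0 /\ exists2 B, 0 < B & forall y, f y <= B * expR (- (y ^+ 2 / 2))].
Proof.
move=> sigma01 l_int sE; have [s0 _] := andP sigma01; have [l0 _] := andP l_int.
have [z z0 [zE xE]] := sigma_of_roots s0 sE.
rewrite !(varphi''E l_int) in zE xE.
exact: (glued_profile sigma01 l0 z0 (is_derive_varphi l_int) (is_derive_dvarphi l_int)
  (fun=> erefl) (varphi_gt0 l_int) (varphi_le_gauss l_int) zE xE).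
Qed.
End Profile.

(** * Comparison with classical subsolutions *)

Section Comparison.
Context {R : realType}.
Implicit Types (sigma x y k t : R) (u w psi : R * R -> R) (p q : R * R).

Lemma near_eq_continuous (T : topologicalType) (f g : T -> R) (a : T) :
  (\forall b \near a, g b = f b) -> {for a, continuous g} -> {for a, continuous f}.
Proof.
move=> fg cg; have fga : g a = f a by exact: nbhs_singleton fg.
rewrite /prop_for /continuous_at -fga.
by apply: cvg_trans cg; apply: near_eq_cvg.
Qed.

Lemma near_gt0_fst p : 0 < p.1 -> \forall q \near p, 0 < q.1.
Proof.
move=> p0; have : \forall t \near p.1, 0 < t by exact: lt_nbhsr.
by apply: (@cvg_fst _ _ (nbhs p.1) (nbhs p.2)).
Qed.

(** The penalty [2 t + x^2] lowers the time derivative and the second space derivative by the same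
    [2 k]. The formulas are available only for positive time, so continuity is transferred by
    equality near the point. *)
Lemma C12_quad w k (psi := fun p => w p - k * (2 * p.1 + p.2 ^+ 2)) : C12 w ->
  C12 psi /\ forall p, 0 < p.1 -> dt psi p = dt w p - 2 * k /\ dxx psi p = dxx w p - 2 * k.
Proof.
move=> wC.
have dpsit p : 0 < p.1 -> is_derive p.1 1 (fun s => psi (s, p.2)) (dt w p - 2 * k).
  move=> p0; have [wt _ _ _] := wC p p0.
  have d := is_deriveB (derivableP wt) (is_deriveZ k (is_deriveD
    (is_deriveZ (2 : R) (is_derive_id (p.1 : R) (1 : R)))
    (is_derive_cst (p.2 ^+ 2 : R) (p.1 : R) 1))).
  apply: is_derive_ext d => //.
  by rewrite /dt derive1E /GRing.scale/= addr0 mulr1 mulrC.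
have dpsix p : 0 < p.1 -> is_derive p.2 1 (fun y => psi (p.1, y)) (dx w p - 2 * k * p.2).
  move=> p0; have [_ wx _ _] := wC p p0.
  have d := is_deriveB (derivableP wx) (is_deriveZ k (is_deriveD
    (is_derive_cst (2 * p.1 : R) (p.2 : R) 1) (is_deriveX 2 (is_derive_id (p.2 : R) (1 : R))))).
  apply: is_derive_ext d => //.
  by rewrite /dx derive1E /GRing.scale/= add0r mulr1 expr1; ring.
have dtE p : 0 < p.1 -> dt psi p = dt w p - 2 * k.
  by move=> p0; rewrite /dt derive1E; have [_ ->] := dpsit p p0.
have dxE p : 0 < p.1 -> dx psi p = dx w p - 2 * k * p.2.
  by move=> p0; rewrite {1}/dx derive1E; have [_ ->] := dpsix p p0.
have dpsixx p : 0 < p.1 -> is_derive p.2 1 (fun y => dx psi (p.1, y)) (dxx w p - 2 * k).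
  move=> p0; have [_ _ wxx _] := wC p p0.
  have d := is_deriveB (derivableP wxx) (is_deriveZ (2 * k) (is_derive_id (p.2 : R) (1 : R))).
  apply: is_derive_ext d => [y|].
    by rewrite dxE.
  by rewrite /dxx -[dx (dx w) p]/(derive1 (fun y => dx w (p.1, y)) p.2) derive1E
    /GRing.scale/= mulr1.
have dxxE p : 0 < p.1 -> dxx psi p = dxx w p - 2 * k.
  by move=> p0; rewrite {1}/dxx -[LHS]/(derive1 (fun y => dx psi (p.1, y)) p.2) derive1E;
    have [_ ->] := dpsixx p p0.
split; last by move=> p p0; split; [exact: dtE|exact: dxxE].
move=> p p0; have [_ _ _ [cw cwt cwx cwxx]] := wC p p0.
have near0 := near_gt0_fst p0.
split; [by have [] := dpsit p p0|by have [] := dpsix p p0|by have [] := dpsixx p p0|].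
split.
- apply: cvgB; first exact: cw.
  apply: cvgM; first exact: cvg_cst.
  apply: cvgD; first by apply: cvgM; [exact: cvg_cst|exact: cvg_fst].
  by apply: cvgM; exact: cvg_snd.
- apply: (@near_eq_continuous _ _ (fun q => dt w q - 2 * k)).
    by apply: filterS near0 => q q0; rewrite dtE.
  by apply: cvgB; [exact: cwt|exact: cvg_cst].
- apply: (@near_eq_continuous _ _ (fun q => dx w q - 2 * k * q.2)).
    by apply: filterS near0 => q q0; rewrite dxE.
  apply: cvgB; first exact: cwx.
  by apply: cvgM; [exact: cvg_cst|exact: cvg_snd].
- apply: (@near_eq_continuous _ _ (fun q => dxx w q - 2 * k)).
    by apply: filterS near0 => q q0; rewrite dxxE.
  by apply: cvgB; [exact: cwxx|exact: cvg_cst].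
Qed.

(** [G] has slope at most 1/2, so a shift of [2 k] costs at most [k]. In the comparison the time
    derivative loses [2 k], and the difference [k] makes the inequality strict. *)
Lemma G_sub_ge sigma a k : sigma ^+ 2 <= 1 -> 0 <= k -> G sigma a - k <= G sigma (a - 2 * k).
Proof.
move=> s1 k0; rewrite {1}/G.
case: (leP 0 a) => a0.
  rewrite (max_l (_ : - a <= 0)) ?oppr_le0// mulr0 subr0.
  by have := G_ge_half (a - 2 * k) s1; lra.
rewrite (max_r (_ : 0 <= - a)) ?oppr_ge0 ?(ltW a0)//.
have := G_ge_half_sigma (a - 2 * k) s1; have := sqr_ge0 sigma; nra.
Qed.

Lemma G_pM sigma a b : 0 <= a -> G sigma (a * b) = a * G sigma b.
Proof.
move=> a0; have maxM x : Num.max 0 (a * x) = a * Num.max 0 x.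
  by rewrite maxr_pMr// mulr0.
by rewrite /G -(mulrN a b) !maxM; ring.
Qed.

(* The penalty [k (2 t + x^2)] also confines [t], so that the minimum of [u - psi]
   is attained at a point interior in time and no terminal time is needed. *)
Lemma comparison sigma phi u w (Mw : R) : sigma ^+ 2 <= 1 -> G_heat_solution sigma phi u ->
  {within [set p : R * R | 0 <= p.1], continuous w} ->
  (forall p, 0 <= p.1 -> w p <= Mw) ->
  (forall x, w (0, x) <= phi x) ->
  C12 w -> (forall p, 0 < p.1 -> dt w p <= G sigma (dxx w p)) ->
  forall p, 0 <= p.1 -> w p <= u p.
Proof.
move=> s1 [cu [Mu [_ Mu_bnd]] u0 _ u_super] cw w_le w0 wC w_sub q0 q00.
rewrite leNgt; apply/negP => uw.
have {Mu_bnd} [M M0 u_ge] : exists2 M, 0 <= M & forall p, 0 <= p.1 -> - M <= u p.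
  have M1 : Mu < `|Mu| + 1 by rewrite ltr_pwDr// ler_norm.
  exists (`|Mu| + 1) => [|p p0]; first by rewrite addr_ge0.
  by have := Mu_bnd _ M1 p p0 => /= /ler_normlP[]; rewrite lerNl.
pose m := w q0 - u q0; have m0 : 0 < m by rewrite subr_gt0.
pose Z p := 2 * p.1 + p.2 ^+ 2.
have Z0 p : 0 <= p.1 -> 0 <= Z p by move=> p0; rewrite addr_ge0 ?sqr_ge0// mulr_ge0.
(* Small enough that [k * Z q0 < m], so the penalized difference is still negative at [q0]. *)
pose k := m / (2 * (Z q0 + 1)).
have k0 : 0 < k by rewrite divr_gt0// mulr_gt0// ltr_wpDl// Z0.
pose psi p := w p - k * Z p.
have [psiC psiE] := C12_quad k wC.
pose h p := u p - psi p.
have hq0 : h q0 < 0.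
  have : k * Z q0 < m.
    rewrite /k mulrAC ltr_pdivrMr ?mulr_gt0 ?ltr_wpDl ?Z0// ltr_pM2l//.
    by have := Z0 _ q00; lra.
  by rewrite /h /psi /m; lra.
(* Outside [K], [Z p >= L], so the penalty outweighs the bounds on [u] and [w]. The [+ 1] ensures
   [L >= 1], hence [L^2 >= L], which is used when [|p.2| > L]. *)
pose L := (M + `|Mw|) / k + 1.
have L1 : 1 <= L by rewrite lerDr divr_ge0// ?addr_ge0// ltW.
pose K := (`[0, L] `*` `[- L, L])%classic : set (R * R).
have out p : 0 <= p.1 -> ~ K p -> 0 <= h p.
  move=> p0 NKp.
  have : M + `|Mw| <= k * Z p.
    rewrite mulrC -ler_pdivrMr//; apply: (@le_trans _ _ L); first by rewrite lerDl.
    have [Lp|pL] := leP L p.1; first by rewrite /Z; have := sqr_ge0 p.2; lra.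
    apply: contra_notT NKp; rewrite -ltNge => ZL; split=> /=; rewrite in_itv/=.
      by rewrite p0 ltW.
    have : p.2 ^+ 2 <= L ^+ 2 by move: ZL; rewrite /Z; nra.
    rewrite -ler_sqrt ?sqr_ge0// !sqrtr_sqr (ger0_norm (le_trans ler01 L1)).
    by rewrite ler_norml.
  by rewrite /h /psi; have := u_ge p p0; have := w_le p p0; have := ler_norm Mw; lra.
have Kq0 : K q0 by apply: contrapT => /(out q0 q00); rewrite leNgt hq0.
have cK : compact K by apply: compact_setX; exact: segment_compact.
have KU : K `<=` [set p : R * R | 0 <= p.1].
  by move=> p [/=]; rewrite in_itv/= => /andP[].
have ch : {within K, continuous h}.
  apply: continuous_subspaceW KU _ => p.
  apply: cvgB; first exact: cu; apply: cvgB; first exact: cw.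
  have cZ : continuous (fun p => k * Z p).
    move=> q; apply: cvgM; first exact: cvg_cst.
    apply: cvgD; first by apply: cvgM; [exact: cvg_cst|exact: cvg_fst].
    by apply: cvgM; exact: cvg_snd.
  exact: (continuous_subspaceT cZ).
have [pm /set_mem Kpm hmin] := compact_EVT_min (ex_intro _ q0 Kq0) cK ch.
have pm_ge0 := KU _ Kpm.
have hpm : h pm < 0 by apply: le_lt_trans hq0; apply: hmin; exact/mem_set.
have hmin' q : 0 <= q.1 -> h pm <= h q.
  move=> q_ge0; have [Kq|NKq] := pselect (K q); first exact/hmin/mem_set.
  exact: le_trans (ltW hpm) (out q q_ge0 NKq).
(* At time 0, [w <= phi = u] and the penalty is nonnegative, so [h >= 0] there, against
   [h pm < 0]. *)
have pm0 : 0 < pm.1.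
  rewrite lt_neqAle pm_ge0 andbT; apply: contraTneq hpm => pm10.
  rewrite -leNgt /h /psi [pm]surjective_pairing -pm10 u0.
  by have := w0 pm.2; have := Z0 pm pm_ge0; rewrite [pm]surjective_pairing -pm10; nra.
have near_min : \forall q \near pm, u pm - psi pm <= u q - psi q.
  by apply: filterS (near_gt0_fst pm0) => q q_gt0; exact: hmin' (ltW q_gt0).
(* At [pm], [dt w - 2 k >= G(dxx w - 2 k) >= G(dxx w) - k >= dt w - k], which contradicts
   [k > 0]. *)
have := u_super psi pm psiC pm0 near_min.
have [-> ->] := psiE pm pm0.
have := w_sub pm pm0; have := G_sub_ge (dxx w pm) s1 (ltW k0).
lra.
Qed.

(** * The shifted self-similar subsolution *)

Section SelfSimilar.
Variables (sigma l eta c delta B : R) (f f1 f2 : R -> R).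
Hypotheses (l0 : 0 < l) (eta0 : 0 < eta) (c0 : 0 <= c) (B0 : 0 <= B).
Hypothesis df : forall y, is_derive y 1 f (f1 y).
Hypothesis df1 : forall y, is_derive y 1 f1 (f2 y).
Hypothesis cf2 : continuous f2.
Hypothesis f_sub : forall y, - l * f y - 2^-1 * y * f1 y <= G sigma (f2 y).
Hypothesis f_le : forall y, f y <= B.

Let r t := (t + eta) `^ (- 2^-1).
(** The time shift [eta] removes the singularity at [t = 0]: the initial datum is a rescaled copy of
    the profile, of width [sqrt eta]. *)
Definition selfsim p : R := c * ((p.1 + eta) `^ (- l) * f (r p.1 * p.2)) - delta.

Let teta t : 0 <= t -> 0 < t + eta.
Proof. by move=> t0; rewrite ltr_wpDl. Qed.

Let is_derive_shift_powR (a t : R) : 0 <= t ->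
  is_derive t 1 (fun t => (t + eta) `^ a) (a * (t + eta) `^ (a - 1)).
Proof.
move=> t0.
have ds := is_deriveD (is_derive_id (t : R) (1 : R)) (is_derive_cst (eta : R) (t : R) 1).
have d := is_derive1_comp (g := id + cst eta) (is_derive1_powR a (teta t0)) ds.
by apply: is_derive_ext d => //; rewrite addr0 mulr1.
Qed.

Let continuous_shift_powR (a : R) p : 0 <= p.1 ->
  {for p, continuous (fun p => (p.1 + eta) `^ a)}.
Proof.
move=> p0; apply: (@continuous_comp _ _ _ (fun p : R * R => p.1 + eta) (@powR R ^~ a)).
  by apply: cvgD; [exact: cvg_fst|exact: cvg_cst].
exact/powR_continuous/teta.
Qed.

Let continuous_profile (g : R -> R) p : continuous g -> 0 <= p.1 ->
  {for p, continuous (fun p => g (r p.1 * p.2))}.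
Proof.
move=> cg p0; apply: (@continuous_comp _ _ _ (fun p : R * R => r p.1 * p.2) g); last exact: cg.
by apply: cvgM; [exact: continuous_shift_powR|exact: cvg_snd].
Qed.

Let cf : continuous f.
Proof. by move=> y; apply/differentiable_continuous/derivable1_diffP; have [] := df y. Qed.

Let cf1 : continuous f1.
Proof. by move=> y; apply/differentiable_continuous/derivable1_diffP; have [] := df1 y. Qed.

Let selfsimx p := c * ((p.1 + eta) `^ (- l) * (r p.1 * f1 (r p.1 * p.2))).
Let selfsimxx p := c * ((p.1 + eta) `^ (- l) * (r p.1 * (r p.1 * f2 (r p.1 * p.2)))).
Let selfsimt p :=
  c * (- l * (p.1 + eta) `^ (- l - 1) * f (r p.1 * p.2) +
       (p.1 + eta) `^ (- l) *
         (f1 (r p.1 * p.2) * (- 2^-1 * (p.1 + eta) `^ (- 2^-1 - 1) * p.2))).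

Let isM (g : R -> R) (a y t : R) :
  is_derive y 1 g t -> is_derive y 1 (fun y => a * g y) (a * t).
Proof. by move=> d; have da := is_deriveZ a d; apply: is_derive_ext da. Qed.

Let is_derive_selfsimx p : is_derive p.2 1 (fun y => selfsim (p.1, y)) (selfsimx p).
Proof.
have d := is_deriveB (isM c (isM ((p.1 + eta) `^ (- l)) (is_derive_scale (r p.1) df p.2)))
  (is_derive_cst (delta : R) (p.2 : R) 1).
by apply: is_derive_ext d => //; rewrite subr0.
Qed.

Let is_derive_selfsimxx p : is_derive p.2 1 (fun y => selfsimx (p.1, y)) (selfsimxx p).
Proof.
exact: (isM c (isM ((p.1 + eta) `^ (- l)) (isM (r p.1) (is_derive_scale (r p.1) df1 p.2)))).
Qed.

Let is_derive_selfsimt p : 0 <= p.1 ->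
  is_derive p.1 1 (fun s => selfsim (s, p.2)) (selfsimt p).
Proof.
move=> p0.
have dr := is_deriveM (is_derive_shift_powR (- 2^-1) p0) (is_derive_cst (p.2 : R) (p.1 : R) 1).
have dfr := is_derive1_comp (g := (fun t => r t) * cst p.2) (df (r p.1 * p.2)) dr.
have d := is_deriveB (isM c (is_deriveM (is_derive_shift_powR (- l) p0) dfr))
  (is_derive_cst (delta : R) (p.1 : R) 1).
apply: is_derive_ext d => //.
rewrite /selfsimt /GRing.scale/= subr0 mulr0 add0r /r.
ring.
Qed.

Let dx_selfsim : dx selfsim = selfsimx.
Proof. by apply/funext => p; rewrite /dx derive1E; have [_ ->] := is_derive_selfsimx p. Qed.

Let dxx_selfsim : dxx selfsim = selfsimxx.
Proof.
apply/funext => p; rewrite /dxx dx_selfsim /dx derive1E.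
by have [_ ->] := is_derive_selfsimxx p.
Qed.

Let dt_selfsim p : 0 <= p.1 -> dt selfsim p = selfsimt p.
Proof. by move=> p0; rewrite /dt derive1E; have [_ ->] := is_derive_selfsimt p0. Qed.

Let selfsim_continuous_at p : 0 <= p.1 -> {for p, continuous selfsim}.
Proof.
move=> p0; apply: cvgB; last exact: cvg_cst.
apply: cvgM; first exact: cvg_cst.
by apply: cvgM; [exact: continuous_shift_powR|exact: continuous_profile].
Qed.

Lemma selfsim_C12 : C12 selfsim.
Proof.
move=> p /[dup] p_gt0 /ltW p0; split.
- by have [] := is_derive_selfsimt p0.
- by have [] := is_derive_selfsimx p.
- by rewrite dx_selfsim; have [] := is_derive_selfsimxx p.
rewrite dx_selfsim dxx_selfsim; split.
- exact: selfsim_continuous_at.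
- apply: (@near_eq_continuous _ _ selfsimt).
    by apply: filterS (near_gt0_fst p_gt0) => q q0; rewrite dt_selfsim// ltW.
  apply: cvgM; first exact: cvg_cst.
  apply: cvgD; apply: cvgM.
  + by apply: cvgM; [exact: cvg_cst|exact: continuous_shift_powR].
  + exact: continuous_profile.
  + exact: continuous_shift_powR.
  + apply: cvgM; first exact: (continuous_profile cf1).
    apply: cvgM; last exact: cvg_snd.
    by apply: cvgM; [exact: cvg_cst|exact: continuous_shift_powR].
- apply: cvgM; first exact: cvg_cst.
  apply: cvgM; first exact: continuous_shift_powR.
  by apply: cvgM; [exact: continuous_shift_powR|exact: continuous_profile].
- apply: cvgM; first exact: cvg_cst.
  apply: cvgM; first exact: continuous_shift_powR.
  do 2!(apply: cvgM; first exact: continuous_shift_powR).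
  exact: continuous_profile.
Qed.

(** Since [r^2 = 1 / s], both sides carry the nonnegative factor [c s^(-l) / s]; as [G] is
    positively homogeneous, what remains is the profile inequality at [y = r x]. *)
Lemma selfsim_sub p : 0 < p.1 -> dt selfsim p <= G sigma (dxx selfsim p).
Proof.
move=> /ltW p0; rewrite dt_selfsim// dxx_selfsim /selfsimt /selfsimxx.
have s0 := teta p0; set s := p.1 + eta in s0 *.
have sB1 a : s `^ (a - 1) = s `^ a * s^-1.
  by rewrite powRD ?powR_inv1 ?(ltW s0)// (gt_eqF s0) implybT.
have rr : r p.1 * r p.1 = s^-1.
  rewrite /r -/s -powRD; last by rewrite (gt_eqF s0) implybT.
  by rewrite -opprD -mulr2n -(mulr_natr (2^-1)) mulVf// powR_inv1// ltW.
rewrite !sB1 -/(r p.1) mulrA [r p.1 * (_ * _)]mulrA rr.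
set y := r p.1 * p.2; set P := s `^ (- l).
rewrite [X in G _ X](_ : _ = c * P * s^-1 * f2 y); last by ring.
rewrite G_pM; last by rewrite !mulr_ge0 ?powR_ge0// invr_ge0 ltW.
rewrite [leLHS](_ : _ = c * P * s^-1 * (- l * f y - 2^-1 * y * f1 y)); last by rewrite /y; ring.
by rewrite ler_wpM2l// !mulr_ge0 ?powR_ge0// invr_ge0 ltW.
Qed.

Lemma selfsim_continuous : {within [set p : R * R | 0 <= p.1], continuous selfsim}.
Proof.
apply: continuous_in_subspaceT => p; rewrite inE; exact: selfsim_continuous_at.
Qed.

Lemma selfsim_le p : 0 <= p.1 -> selfsim p <= c * (eta `^ (- l) * B) - delta.
Proof.
move=> p0; rewrite lerD2r ler_wpM2l//.
apply: (@le_trans _ _ ((p.1 + eta) `^ (- l) * B)).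
  by rewrite ler_wpM2l// powR_ge0.
rewrite ler_wpM2r// !powRN lef_pV2 ?posrE ?powR_gt0 ?teta//.
by apply: ge0_ler_powR; rewrite ?nnegrE ?(ltW l0) ?(ltW eta0) ?(ltW (teta p0))// lerDr.
Qed.
End SelfSimilar.
End Comparison.

(** * Lower bound for the capacity *)

Section Capacity.
Context {R : realType}.
Implicit Types (x y k t : R) (u w psi : R * R -> R) (p q : R * R).

(** Here [g1 x = 0]; if [a < 0], then [g1 < 0] just to the right of [x], and the mean value theorem
    pushes [g] below [g x]. *)
Lemma local_min_derive (g g1 : R -> R) x (a : R) : 
  (forall y, is_derive y 1 g (g1 y)) -> is_derive x 1 g1 a ->
  (\forall y \near x, g x <= g y) -> 0 <= a.
Proof.
move=> dg dg1 gmin.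
have [e /= e0 gmin_e] : exists2 e : R, 0 < e & forall y, `|x - y| < e -> g x <= g y.
  by move: gmin => [e e0 ge]; exists e.
have g1x : g1 x = 0.
  have [_ <-] := dg x.
  have [_ ->//] : is_derive x 1 g 0.
  apply: (@derive1_at_min _ _ (x - e) (x + e)).
  - lra.
  - by move=> t _; have [] := dg t.
  - by rewrite in_itv/=; apply/andP; split; lra.
  - move=> t; rewrite in_itv/= => /andP[t1 t2]; apply: gmin_e.
    by rewrite ltr_norml; apply/andP; split; lra.
rewrite leNgt; apply/negP => a0.
have [/cvg_ex[/= L gL] gE] := dg1.
have La : L = a by rewrite -gE; apply/esym/cvg_lim => //; exact: gL.
rewrite La in gL.
have [d /= d0 g1_neg] : exists2 d : R, 0 < d & forall h, 0 < h < d -> g1 (h + x) < 0.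
  have : \forall h \near 0^', h^-1 *: (g1 (h *: 1 + x) - g1 x) < 0.
    exact: (cvgr_lt _ gL).
  move=> [d d0 gd]; exists d => // h /andP[h0 hd].
  have := gd h; rewrite /= sub0r normrN (gtr0_norm h0) => /(_ hd (lt0r_neq0 h0)).
  by rewrite g1x subr0 /GRing.scale/= mulr1 pmulr_rlt0 ?invr_gt0.
pose h := Num.min d e / 2.
have h0 : 0 < h by rewrite divr_gt0// lt_min d0.
have hd : h < d by rewrite ltr_pdivrMr// mulr_natr mulr2n ltr_pwDr// ge_min lexx.
have he : h < e by rewrite ltr_pdivrMr// mulr_natr mulr2n ltr_pwDr// ge_min lexx orbT.
have xh : x < x + h by rewrite ltrDl.
have cg : {within `[x, x + h], continuous g}.
  by apply: derivable_within_continuous => t _; have [] := dg t.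
have [c] := MVT xh (fun t _ => dg t) cg.
rewrite in_itv/= => /andP[c1 c2] gE'.
have : g1 (c - x + x) < 0 by apply: g1_neg; apply/andP; split; lra.
have : g x <= g (x + h) by apply: gmin_e; rewrite opprD addrA subrr sub0r normrN gtr0_norm.
rewrite subrK; rewrite -subr_ge0 gE' addrAC subrr add0r pmulr_lge0// => h1 h2.
by have := lt_le_trans h2 h1; rewrite ltxx.
Qed.

Lemma C12_local_min psi p : C12 psi -> 0 < p.1 ->
  (\forall q \near p, psi p <= psi q) -> dt psi p = 0 /\ 0 <= dxx psi p.
Proof.
move=> psiC p0 /nbhs_ballP[e /= e0 min_e]; split.
  rewrite /dt derive1E.
  have [_ ->//] : is_derive p.1 1 (fun s => psi (s, p.2)) 0.
  (* The interval is clipped at 0 because [C12] gives differentiability for positive times only. *)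
  apply: (@derive1_at_min _ _ (Num.max 0 (p.1 - e)) (p.1 + e)).
  - by rewrite ge_max; apply/andP; split; lra.
  - move=> t; rewrite in_itv/= gt_max => /andP[/andP[t0 _] _].
    by have [dpsi _ _ _] := psiC (t, p.2) t0; exact: dpsi.
  - by rewrite in_itv/= gt_max p0/=; apply/andP; split; lra.
  - move=> t; rewrite in_itv/= gt_max => /andP[/andP[_ t1] t2] /=.
    rewrite -surjective_pairing; apply: min_e; split => /=; last exact: ballxx.
    by rewrite /ball/= ltr_norml; apply/andP; split; lra.
apply: (@local_min_derive (fun y => psi (p.1, y)) (fun y => dx psi (p.1, y)) p.2).
- move=> y; have [_ dpsi _ _] := psiC (p.1, y) p0.
  by rewrite /dx derive1E; exact: derivableP.
- have [_ _ dpsi _] := psiC p p0.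
  rewrite /dxx -[dx (dx psi) p]/(derive1 (fun y => dx psi (p.1, y)) p.2) derive1E.
  exact: derivableP.
- exists e => // y /= py; rewrite -surjective_pairing; apply: min_e; split => //=.
  exact: ballxx.
Qed.

Lemma G_le0 (sigma a : R) : a <= 0 -> G sigma a <= 0.
Proof.
move=> a0; rewrite /G max_l// (max_r (_ : 0 <= - a)) ?oppr_ge0//.
by rewrite mulr_ge0_le0// sub0r oppr_le0 mulr_ge0 ?sqr_ge0// oppr_ge0.
Qed.

Lemma G_ge0 (sigma a : R) : 0 <= a -> 0 <= G sigma a.
Proof.
move=> a0; rewrite /G max_r// (max_l (_ : - a <= 0)) ?oppr_le0//.
by rewrite mulr0 subr0 mulr_ge0.
Qed.

Lemma C12_local_max psi p : C12 psi -> 0 < p.1 ->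
  (\forall q \near p, psi q <= psi p) -> dt psi p = 0 /\ dxx psi p <= 0.
Proof.
move=> psiC p0 /nbhs_ballP[e /= e0 max_e]; split.
  rewrite /dt derive1E.
  have [_ ->//] : is_derive p.1 1 (fun s => psi (s, p.2)) 0.
  apply: (@derive1_at_max _ _ (Num.max 0 (p.1 - e)) (p.1 + e)).
  - by rewrite ge_max; apply/andP; split; lra.
  - move=> t; rewrite in_itv/= gt_max => /andP[/andP[t0 _] _].
    by have [dpsi _ _ _] := psiC (t, p.2) t0; exact: dpsi.
  - by rewrite in_itv/= gt_max p0/=; apply/andP; split; lra.
  - move=> t; rewrite in_itv/= gt_max => /andP[/andP[_ t1] t2] /=.
    rewrite -surjective_pairing; apply: max_e; split => /=; last exact: ballxx.
    by rewrite /ball/= ltr_norml; apply/andP; split; lra.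
rewrite -oppr_ge0.
apply: (@local_min_derive (fun y => - psi (p.1, y)) (fun y => - dx psi (p.1, y)) p.2).
- move=> y; have [_ dpsi _ _] := psiC (p.1, y) p0.
  have d := is_deriveN (derivableP dpsi).
  by apply: is_derive_ext d => [//|]; rewrite /dx derive1E.
- have [_ _ dpsi _] := psiC p p0.
  have d := is_deriveN (derivableP dpsi).
  apply: is_derive_ext d => [//|].
  by rewrite /dxx -[dx (dx psi) p]/(derive1 (fun y => dx psi (p.1, y)) p.2) derive1E.
- exists e => // y /= py; rewrite -surjective_pairing lerN2; apply: max_e; split => //=.
  exact: ballxx.
Qed.

(** Provides the competitor [phi = 1], hence the nonemptiness needed to bound [inf] from below. A
    test function touching a constant has a local extremum, where [dt] vanishes and [dxx] has the
    sign that the inequality requires. *)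
Lemma G_heat_solution_cst (sigma a : R) : G_heat_solution sigma (cst a) (cst a).
Proof.
split => //.
- by move=> p; exact: cvg_cst.
- by exists `|a|; split=> [|M aM p _ /=]; [exact: num_real|exact: ltW].
- move=> psi p psiC p0 psi_min.
  have [|-> d2] := C12_local_min psiC p0.
    by apply: filterS psi_min => q /=; rewrite lerD2l lerN2.
  by rewrite sub0r oppr_le0 G_ge0.
- move=> psi p psiC p0 psi_max.
  have [|-> d2] := C12_local_max psiC p0.
    by apply: filterS psi_max => q /=; rewrite lerD2l lerN2.
  by rewrite sub0r oppr_ge0 G_le0.
Qed.

Lemma G_capacity_ge (sigma a b v : R) :
  (forall phi u, (forall x, \1_`[a, b] x <= phi x) -> G_heat_solution sigma phi u ->
    v <= u (1, 0)) ->
  v <= G_capacity sigma a b.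
Proof.
move=> v_le; apply: lb_le_inf.
  exists 1, (cst 1); split.
  - split.
    + by exists 1; split=> [|M M1 x _ /=]; [exact: num_real|rewrite normr1 ltW].
    + exists 0; split=> [|M M0 [x y] _ /=]; first exact: num_real.
      by rewrite subrr normr0 mulr_ge0// ltW.
  - by move=> x; rewrite indicE; case: (_ \in _).
  - by exists (cst 1) => //; exact: G_heat_solution_cst.
by move=> _ [phi [_ phi_ge [u uP ->]]]; exact: v_le uP.
Qed.

End Capacity.

(** * Choice of parameters and passage to the limit *)

Section LowerBound.
Context {R : realType}.
Implicit Types (x y k t : R).

Lemma G_capacity_lower_bound (sigma l : R) :
  0 < sigma < 1 -> 0 < l < 2^-1 -> sigma_of l = sigma ->
  exists2 c : R, 0 < c & forall eps eta : R, 0 < eps -> 0 < eta <= 1 ->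
    c * eta `^ l - expR (- (eps ^+ 2 / eta / 2)) <= G_capacity sigma (- eps) eps.
Proof.
move=> sigma01 l_int sE.
have [f [f1 [f2 [df df1 cf2 f_sub [f0 [B B0 f_gauss]]]]]] := profile sigma01 l_int sE.
have [l0 _] := andP l_int.
have s2 : sigma ^+ 2 <= 1.
  by move/andP: sigma01 => [s0 s1]; rewrite expr_le1// ltW.
have f_le y : f y <= B.
  apply: le_trans (f_gauss y) _; rewrite ger_pMr// -[leRHS]expR0 ler_expR.
  by rewrite oppr_le0 divr_ge0// sqr_ge0.
(* The subsolution at [(1, 0)] is [B^-1 eta^l (1 + eta)^(-l) f(0) - delta], and [1 + eta <= 2]. *)
exists (B^-1 * 2 `^ (- l) * f 0); first by rewrite !mulr_gt0 ?invr_gt0 ?powR_gt0.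
move=> eps eta eps0 /andP[eta0 eta1].
apply: G_capacity_ge => phi u phi_ge u_sol.
pose delta := expR (- (eps ^+ 2 / eta / 2)).
pose c := B^-1 * eta `^ l.
have c0 : 0 <= c by rewrite mulr_ge0 ?powR_ge0// invr_ge0 ltW.
pose w := selfsim l eta c delta f.
have cE : c * eta `^ (- l) = B^-1.
  by rewrite /c powRN mulfK// gt_eqF// powR_gt0.
have w0 x : w (0, x) <= phi x.
  apply: le_trans (phi_ge x); rewrite /w /selfsim/= add0r mulrA cE.
  set y := _ * x.
  have yE : y ^+ 2 = x ^+ 2 / eta.
    rewrite /y exprMn mulrC; congr (_ * _).
    rewrite -powR_mulrn ?powR_ge0// -powRrM mulNr mulVf//.
    by rewrite powR_inv1// ltW.
  have : B^-1 * f y <= expR (- (x ^+ 2 / eta / 2)).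
    by rewrite mulrC ler_pdivrMr// mulrC -yE.
  (* On the interval the Gaussian is at most 1 and [delta >= 0]; off it [x^2 > eps^2], so the
     Gaussian is at most [delta] and [w <= 0]. *)
  rewrite indicE mem_setE in_itv/=; case: (boolP (_ && _)) => /= xin h.
    have : expR (- (x ^+ 2 / eta / 2)) <= 1.
      by rewrite -[leRHS]expR0 ler_expR oppr_le0 !divr_ge0 ?sqr_ge0// ltW.
    by have := expR_ge0 (- (eps ^+ 2 / eta / 2)); rewrite -/delta; lra.
  have : expR (- (x ^+ 2 / eta / 2)) <= delta.
    rewrite ler_expR lerN2 ler_pM2r ?invr_gt0// ler_pM2r ?invr_gt0//.
    rewrite -[leRHS]real_normK ?num_real// ler_sqr ?nnegrE ?(ltW eps0)//.
    by move: xin; rewrite -ler_norml -ltNge => /ltW.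
  by lra.
have w_le p : 0 <= p.1 -> w p <= c * (eta `^ (- l) * B) - delta.
  by move=> p0; exact: (selfsim_le _ l0 eta0 c0 (ltW B0) f_le).
have wC : C12 w by exact: (selfsim_C12 _ _ _ eta0 df df1 cf2).
have w_sub p : 0 < p.1 -> dt w p <= G sigma (dxx w p).
  by move=> p0; exact: (selfsim_sub _ eta0 c0 df df1 f_sub).
have cw : {within [set p : R * R | 0 <= p.1], continuous w}.
  exact: (selfsim_continuous eta0 df).
have := comparison s2 u_sol cw w_le w0 wC w_sub (p := (1, 0)) ler01.
apply: le_trans; rewrite /w /selfsim/= mulr0 lerD2r.
rewrite /c [leLHS](_ : _ = B^-1 * eta `^ l * (2 `^ (- l) * f 0)); last by ring.
rewrite ler_wpM2l// ler_wpM2r ?(ltW f0)// !powRN lef_pV2 ?posrE ?powR_gt0//; last first.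
  by rewrite addr_gt0.
apply: ge0_ler_powR; rewrite ?nnegrE ?(ltW l0)//.
  by rewrite addr_ge0// ltW.
by lra.
Qed.

(** With an integer [n >= q], [r^q <= r^n], and one term of the exponential series gives
    [(r/2)^n / n! <= exp(r/2)]. *)
Lemma powR_expRN_bounded (q : R) : exists K : R, forall r, 1 <= r ->
  r `^ q * expR (- (r / 2)) <= K.
Proof.
pose n := (Num.truncn `|q|).+1.
exists (2 ^+ n * n`!%:R) => r r1.
have r0 : 0 <= r by apply: le_trans r1.
have qn : q <= n%:R.
  by rewrite (le_trans (ler_norm q))// ltW// truncnS_gt.
apply: (@le_trans _ _ (r ^+ n * expR (- (r / 2)))).
  by rewrite ler_wpM2r ?expR_ge0// -powR_mulrn//; exact: ler_powR.
rewrite expRN ler_pdivrMr ?expR_gt0//.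
have r2 : 0 <= r / 2 by rewrite divr_ge0.
have : (r / 2) ^+ n / n`!%:R <= expR (r / 2).
  by apply: le_trans (expR_ge1Dxn (Num.truncn `|q|) r2); rewrite lerDr.
rewrite ler_pdivrMr ?ltr0n ?fact_gt0// exprMn exprVn.
rewrite ler_pdivrMr ?exprn_gt0// => /le_trans; apply.
by rewrite [leRHS]mulrC (mulrC (2 ^+ n)) mulrA.
Qed.

Lemma limf_einf_pinfty (h : R -> R) (F : set_system R) : 
  (forall A, \forall e \near F, A <= h e) ->
  limf_einf (EFin \o h) F = +oo%E.
Proof.
move=> hF; rewrite limf_einfE; apply/eqyP => A A0.
apply: (@le_trans _ _ (ereal_inf [set (h x)%:E | x in [set e | A <= h e]])).
  by apply: le_ereal_inf_tmp => _ [e /= Ae <-]; rewrite lee_fin.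
apply: ereal_sup_ubound; exists [set e | A <= h e] => //.
exact: hF.
Qed.
End LowerBound.

Theorem corollary4p3 (R : realType) (sigma : R) (hsigma : 0 < sigma < 1)
    (lambda_sigma : R) (hlambda_sigma : is_lambda_of sigma lambda_sigma)
    (lambda : R) (hlambda : lambda_sigma < lambda < 2^-1) :
  limf_einf
    (fun eps : R =>
       (G_capacity sigma (- eps) eps / eps `^ (2 * lambda))%:E) 0^'+ = +oo%E.
Proof.
have [l_int sE] := hlambda_sigma; have [l0 l12] := andP l_int.
have [ll _] := andP hlambda.
set l := lambda_sigma in l_int sE l0 l12 ll.
have [c c0 c_le] := G_capacity_lower_bound hsigma l_int sE.
have lam0 : 0 < lambda by apply: lt_trans ll.
pose m := (lambda - l) / l; have m0 : 0 < m by rewrite divr_gt0// subr_gt0.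
(* For [r = eps^(-m)] this power of [r] is [eps^(-2 lambda)], so [K] bounds the subtracted
   exponential divided by [eps^(2 lambda)]. *)
have [K KP] := powR_expRN_bounded (2 * lambda / m).
apply: limf_einf_pinfty => A.
(* The threshold makes [c eps^(l - lambda) - K >= A], the bound left after division by
   [eps^(2 lambda)]. *)
have near_large : \forall eps \near 0^'+, (A + K) / c <= (eps `^ (lambda - l))^-1.
  have ll0 : 0 < lambda - l by rewrite subr_gt0.
  have pos : \forall eps \near 0^'+, (0 : R) < eps `^ (lambda - l).
    by apply: filterS (nbhs_right_gt 0) => eps; exact: powR_gt0.
  have H := (cvgrVy pos).2 (powR_cvg0 ll0).
  exact: ((cvgryPge _).1 (H _)).
have powRB1 x a b : 0 < x -> x `^ (a - b) = x `^ a * (x `^ b)^-1.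
  by move=> x0; rewrite powRB// (gt_eqF x0) implybT.
near=> eps.
have eps0 : 0 < eps by near: eps; exact: nbhs_right_gt.
have eps1 : eps <= 1 by near: eps; exact: nbhs_right_le.
have large : (A + K) / c <= (eps `^ (lambda - l))^-1 by near: eps; exact: near_large.
have eps01 : 0 < eps <= 1 by rewrite eps0.
pose eta := eps `^ (2 + m).
have eta01 : 0 < eta <= 1.
  rewrite powR_gt0//= -[leRHS](powRr0 eps); apply: ger_powR => //.
  by rewrite addr_ge0// ltW.
have e1 : eta `^ l = eps `^ (2 * lambda) * (eps `^ (lambda - l))^-1.
  rewrite -powRB1// -powRrM; congr (_ `^ _).
  by rewrite mulrDl divfK ?gt_eqF//; ring.
pose r := eps `^ (- m).
have r1 : 1 <= r.
  by rewrite -[leLHS](powRr0 eps); apply: ger_powR => //; rewrite oppr_le0 ltW.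
have e2 : eps ^+ 2 / eta = r.
  by rewrite -powR_mulrn ?(ltW eps0)// -powRB1//; congr (_ `^ _); ring.
have e3 : r `^ (2 * lambda / m) = (eps `^ (2 * lambda))^-1.
  by rewrite -powRN -powRrM; congr (_ `^ _); rewrite mulNr mulrC divfK// gt_eqF.
have E0 : 0 < eps `^ (2 * lambda) by rewrite powR_gt0.
have := c_le eps eta eps0 eta01; rewrite e1 e2.
have := KP r r1; rewrite e3 mulrC ler_pdivrMr// => h1 h2.
rewrite ler_pdivlMr//; apply: le_trans h2.
move: large; rewrite ler_pdivrMr// => h3.
have := ler_wpM2l (ltW E0) h3; lra.
Unshelve. all: end_near. Qed.
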